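(* The node time complexity and the branch time complexity of algorithm maxRPC3, and likewise of its light version lmaxRPC3, are $O(end^3)$, where $n$ is the number of variables, $e$ the number of constraints and $d$ the maximum domain size of the binary CSP.
   Context: **Problem.** A binary CSP consists of variables $X=\{x_1,\dots,x_n\}$, finite domains $D(x_1),\dots,D(x_n)$ of size at most $d$, and a set $C$ of $e$ binary constraints; the constraint on $\{x_i,x_j\}$, if present, is denoted $c_{ij}$ (also $c_{ji}$) and specifies the allowed pairs of values. $D(x_i)$ always denotes the current domain. Each initial domain is totally ordered (lexicographic order); iteration over a domain is in this order. isConsistent$(a_i,a_j)$ tests whether $(a_i,a_j)$ is allowed by $c_{ij}$; one such test is a constraint check and takes constant time. An AC-support of $a_i$ in $D(x_j)$ is an $a_j\in D(x_j)$ such that $(a_i,a_j)$ satisfies $c_{ij}$. It is a PC-support if moreover for every third variable $x_k$ there is $a_k\in D(x_k)$ (a PC-witness) that is an AC-support of both $a_i$ and $a_j$. A value is maxRPC iff it has an AC-support, which is also a PC-support, in $D(x_j)$ for each constraint $c_{ij}$. **Complexity measures.** Time complexities give the asymptotic number of constraint checks. The node time complexity of an algorithm is the worst-case time complexity of invoking it after a variable assignment. The branch time complexity is the worst-case total time complexity of any incremental sequence of $k\le n$ invocations, i.e. of incrementally running the algorithm down a branch of the search tree until a fail occurs. **Data structures.** For each constraint $c_{ij}$ and $a_i\in D(x_i)$ there are pointers $LastPC_{x_i,a_i,x_j}$ and $LastAC_{x_i,a_i,x_j}$ to the most recently discovered PC-support, resp. AC-support, of $a_i$ in $D(x_j)$;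 initially all are NIL, which precedes all values. They are maintained incrementally (carried forward along a branch, restored upon backtracking). ''$+1$'' denotes the next value in the order. $L$ is a list (set) of variables. seekACsupport$(x_i,a_i,x_k)$ makes $LastAC_{x_i,a_i,x_k}$ point to the smallest AC-support of $a_i$ in the current $D(x_k)$ (leaving it unchanged if it is still in $D(x_k)$, otherwise searching forward from it) and returns true; it returns false if no AC-support exists. **Invocation after an assignment.** $L$ is initialized with the currently assigned variable (whose domain is reduced to the assigned value). **maxRPC3 (main loop).** While $L\ne\emptyset$: remove some $x_j$ from $L$. For each $x_i$ with $c_{ij}\in C$: for each $a_i\in D(x_i)$: if searchPCsup$(a_i,x_j)$ is false, delete $a_i$ and add $x_i$ to $L$; otherwise, if checkPCwit$(a_i,x_j)$ is false, delete $a_i$ and add $x_i$ to $L$. After processing the values of $x_i$, if $D(x_i)=\emptyset$ return FAILURE. When $L=\emptyset$ return SUCCESS. **lmaxRPC3** is obtained from maxRPC3 by omitting the call to checkPCwit (and the deletion depending on it) in the main loop. **searchPCsup$(a_i,x_j)$.** If $LastPC_{x_i,a_i,x_j}\in D(x_j)$ return true. Otherwise let $b_j=\max(LastPC_{x_i,a_i,x_j}+1,\,LastAC_{x_i,a_i,x_j})$ if $LastAC_{x_i,a_i,x_j}\in D(x_j)$, else $b_j=\max(LastPC_{x_i,a_i,x_j}+1,\,LastAC_{x_i,a_i,x_j}+1)$. For each $a_j\in D(x_j)$ with $a_j\ge b_j$: if isConsistent$(a_i,a_j)$ then [if $LastAC_{x_i,a_i,x_j}\notin D(x_j)$ and $LastAC_{x_i,a_i,x_j}>LastPC_{x_i,a_i,x_j}$,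 set $LastAC_{x_i,a_i,x_j}=a_j$; if searchPCwit$(a_i,a_j)$, set $LastPC_{x_i,a_i,x_j}=a_j$ and return true]. Return false. **searchPCwit$(a_i,a_j)$.** For each $x_k$ with $c_{ik},c_{jk}\in C$: if ($LastAC_{x_i,a_i,x_k}\in D(x_k)$ and isConsistent$(LastAC_{x_i,a_i,x_k},a_j)$) or ($LastAC_{x_j,a_j,x_k}\in D(x_k)$ and isConsistent$(LastAC_{x_j,a_j,x_k},a_i)$), continue with the next $x_k$. Otherwise, if seekACsupport$(x_i,a_i,x_k)$ or seekACsupport$(x_j,a_j,x_k)$ is false, return false; let $b_k=\max(LastAC_{x_i,a_i,x_k},LastAC_{x_j,a_j,x_k})$ and search the values $a_k\in D(x_k)$, $a_k\ge b_k$, for the first one with isConsistent$(a_i,a_k)$ and isConsistent$(a_j,a_k)$; if none exists return false. Return true after all $x_k$. **checkPCwit$(a_i,x_j)$.** For each $x_k$ with $c_{ik},c_{kj}\in C$: set witness = false. (First part) If $a_k:=LastPC_{x_i,a_i,x_k}\in D(x_k)$: if ($LastAC_{x_i,a_i,x_j}\in D(x_j)$ and isConsistent$(LastAC_{x_i,a_i,x_j},a_k)$) or ($LastAC_{x_k,a_k,x_j}\in D(x_j)$ and isConsistent$(LastAC_{x_k,a_k,x_j},a_i)$), set witness = true; otherwise, if both seekACsupport$(x_i,a_i,x_j)$ and seekACsupport$(x_k,a_k,x_j)$ succeed, search the values $a_j\in D(x_j)$ with $a_j\ge\max(LastAC_{x_i,a_i,x_j},LastAC_{x_k,a_k,x_j})$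 for one consistent with both $a_i$ and $a_k$, and if one is found set witness = true. (Second part) If witness is false and $D(x_k)$ contains a value greater than $LastPC_{x_i,a_i,x_k}$: let $b_k=\max(LastPC_{x_i,a_i,x_k}+1,LastAC_{x_i,a_i,x_k})$ if $LastAC_{x_i,a_i,x_k}\in D(x_k)$, else $b_k=\max(LastPC_{x_i,a_i,x_k}+1,LastAC_{x_i,a_i,x_k}+1)$; for each $a_k\in D(x_k)$, $a_k\ge b_k$: if isConsistent$(a_i,a_k)$ then [if $LastAC_{x_i,a_i,x_k}\notin D(x_k)$ and $LastAC_{x_i,a_i,x_k}>LastPC_{x_i,a_i,x_k}$, set $LastAC_{x_i,a_i,x_k}=a_k$; if searchPCwit$(a_i,a_k)$, set $LastPC_{x_i,a_i,x_k}=a_k$, witness = true, and stop this search]. If witness is still false return false. Return true after all $x_k$. *)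

(* Defs.v *)
From mathcomp Require Import all_boot.

Set Implicit Arguments.
Unset Strict Implicit.
Unset Printing Implicit Defensive.

(* A binary CSP. Every initial domain is a finite totally ordered set; its
   elements are named by their rank, so the initial domain of x is
   {1, ..., dsize x} in its order and the value following v is v.+1. The number
   0 is not a value: it is the pointer NIL, which precedes all values.
   [allowed x a y b]: the pair (a, b) is allowed by the constraint on {x, y}
   (only relevant when [constrained x y]). *)
Record csp := CSP {
  nvar : nat;
  dsize : 'I_nvar -> nat;
  constrained : rel 'I_nvar;
  constrained_sym : symmetric constrained;
  constrained_irr : irreflexive constrained;
  allowed : 'I_nvar -> nat -> 'I_nvar -> nat -> bool;
  allowed_sym : forall x a y b, allowed x a y b = allowed y b x a
}.

(* Each constraint is an unordered pair, counted through its increasing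
   orientation. *)
Definition nconstr (P : csp) : nat :=
  #|[set p : 'I_(nvar P) * 'I_(nvar P) | (p.1 < p.2) && constrained p.1 p.2]|.

Definition maxdom (P : csp) : nat := \max_(x < nvar P) dsize x.

Definition NIL : nat := 0.

Inductive algorithm := maxRPC3 | lmaxRPC3.

Inductive status := Running | Success | Failure.

Section Algorithm.

Variable P : csp.

Notation var := 'I_(nvar P).
Notation value := nat.

(* [dom] lists the current domains in increasing order; [checks] is the number
   of constraint checks made so far. *)
Record state := State {
  dom : var -> seq value;
  lastPC : var * value * var -> value;
  lastAC : var * value * var -> value;
  queue : {set var};
  checks : nat
}.

Definition set_dom D s :=
  State D (lastPC s) (lastAC s) (queue s) (checks s).
Definition set_lastPC p s :=
  State (dom s) p (lastAC s) (queue s) (checks s).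
Definition set_lastAC p s :=
  State (dom s) (lastPC s) p (queue s) (checks s).
Definition set_queue L s :=
  State (dom s) (lastPC s) (lastAC s) L (checks s).
Definition set_checks c s :=
  State (dom s) (lastPC s) (lastAC s) (queue s) c.

(* Imperative programs with unspecified choices: [m s a s'] means that some
   execution of m from state s returns a in state s'. *)
Definition prog (A : Type) := state -> A -> state -> Prop.

Definition ret A (a : A) : prog A := fun s b s' => b = a /\ s' = s.
Definition bind A B (m : prog A) (f : A -> prog B) : prog B :=
  fun s b s'' => exists a s', m s a s' /\ f a s' b s''.
Definition gets A (f : state -> A) : prog A :=
  fun s a s' => a = f s /\ s' = s.
Definition modify (f : state -> state) : prog unit :=
  fun s _ s' => s' = f s.
Definition choose A (Q : A -> Prop) : prog A :=
  fun s a s' => Q a /\ s' = s.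

Local Notation "'let*' x := m 'in' k" := (bind m (fun x => k))
  (at level 200, x name, m at level 100, k at level 200).
Local Notation "m1 ;; m2" := (bind m1 (fun _ => m2))
  (at level 199, right associativity).

Definition orM (m1 m2 : prog bool) : prog bool :=
  let* b := m1 in if b then ret true else m2.
Definition andM (m1 m2 : prog bool) : prog bool :=
  let* b := m1 in if b then m2 else ret false.

(* [hasM] stops at the first success and [allM] at the first failure. *)
Fixpoint hasM T (f : T -> prog bool) (r : seq T) : prog bool :=
  if r is x :: r' then orM (f x) (hasM f r') else ret false.
Fixpoint allM T (f : T -> prog bool) (r : seq T) : prog bool :=
  if r is x :: r' then andM (f x) (allM f r') else ret true.
Fixpoint eachM T (f : T -> prog unit) (r : seq T) : prog unit :=
  if r is x :: r' then f x ;; eachM f r' else ret tt.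

(* The order in which a loop goes through a set of variables is unspecified. *)
Definition any_order (V : pred var) : prog (seq var) :=
  choose (fun r => perm_eq r (enum V)).

Definition isConsistent (x : var) (a : value) (y : var) (b : value)
    : prog bool :=
  modify (fun s => set_checks (checks s).+1 s) ;;
  ret (allowed x a y b).

Definition setPC (x : var) (a : value) (y : var) (b : value) : prog unit :=
  modify (fun s => set_lastPC [eta lastPC s with (x, a, y) |-> b] s).
Definition setAC (x : var) (a : value) (y : var) (b : value) : prog unit :=
  modify (fun s => set_lastAC [eta lastAC s with (x, a, y) |-> b] s).

Definition delete (x : var) (a : value) : prog unit :=
  modify (fun s => set_dom [eta dom s with x |-> rem a (dom s x)] s) ;;
  modify (fun s => set_queue (x |: queue s) s).

Definition seekACsupport (x : var) (a : value) (z : var) : prog bool :=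
  let* p := gets (fun s => lastAC s (x, a, z)) in
  let* D := gets (fun s => dom s z) in
  if p \in D then ret true else
  hasM (fun c => andM (isConsistent x a z c) (setAC x a z c ;; ret true))
       [seq c <- D | p < c].

Definition lastAC_is_witness (x : var) (a : value) (y : var) (b : value)
    (z : var) : prog bool :=
  let* p := gets (fun s => lastAC s (x, a, z)) in
  let* D := gets (fun s => dom s z) in
  if p \in D then isConsistent z p y b else ret false.

(* The search for a PC-witness in D(z) of the pair (x, a), (y, b), common to
   searchPCwit and to the first part of checkPCwit. *)
Definition findPCwit (x : var) (a : value) (y : var) (b : value) (z : var)
    : prog bool :=
  orM (orM (lastAC_is_witness x a y b z) (lastAC_is_witness y b x a z))
      (andM (andM (seekACsupport x a z) (seekACsupport y b z))
         (let* p := gets (fun s => lastAC s (x, a, z)) in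
          let* q := gets (fun s => lastAC s (y, b, z)) in
          let* D := gets (fun s => dom s z) in
          hasM (fun c => andM (isConsistent x a z c) (isConsistent y b z c))
               [seq c <- D | maxn p q <= c])).

Definition searchPCwit (x : var) (a : value) (y : var) (b : value)
    : prog bool :=
  let* r := any_order (fun z => constrained x z && constrained y z) in
  allM (findPCwit x a y b) r.

(* The search for a PC-support of (x, a) in D(y) beyond its LastPC pointer,
   common to searchPCsup and to the second part of checkPCwit. *)
Definition nextPCsup (x : var) (a : value) (y : var) : prog bool :=
  let* pc := gets (fun s => lastPC s (x, a, y)) in
  let* ac := gets (fun s => lastAC s (x, a, y)) in
  let* D := gets (fun s => dom s y) in
  let start := if ac \in D then maxn pc.+1 ac else maxn pc.+1 ac.+1 in
  hasM (fun b =>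
      andM (isConsistent x a y b)
        (let* stale := gets (fun s => (lastAC s (x, a, y) \notin dom s y)
                            && (lastPC s (x, a, y) < lastAC s (x, a, y))) in
         (if stale then setAC x a y b else ret tt) ;;
         andM (searchPCwit x a y b) (setPC x a y b ;; ret true)))
    [seq b <- D | start <= b].

Definition searchPCsup (x : var) (a : value) (y : var) : prog bool :=
  orM (gets (fun s => lastPC s (x, a, y) \in dom s y)) (nextPCsup x a y).

Definition checkPCwit (x : var) (a : value) (y : var) : prog bool :=
  let* r := any_order (fun z => constrained x z && constrained z y) in
  allM (fun z =>
      let* p := gets (fun s => lastPC s (x, a, z)) in
      let* D := gets (fun s => dom s z) in
      orM (if p \in D then findPCwit x a z p y else ret false)
          (if has (fun c => p < c) D then nextPCsup x a z else ret false))
    r.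

Definition supported (alg : algorithm) (x : var) (a : value) (y : var)
    : prog bool :=
  match alg with
  | maxRPC3 => andM (searchPCsup x a y) (checkPCwit x a y)
  | lmaxRPC3 => searchPCsup x a y
  end.

Definition revise (alg : algorithm) (x y : var) : prog unit :=
  let* D := gets (fun s => dom s x) in
  eachM (fun a => let* ok := supported alg x a y in
                  if ok then ret tt else delete x a) D.

(* One iteration of the main loop; it returns false when a domain is wiped
   out. *)
Definition main_iter (alg : algorithm) : prog bool :=
  let* L := gets queue in
  let* y := choose (fun y => y \in L) in
  modify (set_queue (L :\ y)) ;;
  let* r := any_order (fun x => constrained x y) in
  allM (fun x => revise alg x y ;; gets (fun s => dom s x != [::])) r.

(* The executions of the main loop from a given state, including the unfinished
   ones (status [Running]): a bound on the checks of all of them needs no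
   separate termination hypothesis. *)
Inductive run (alg : algorithm) (s0 : state) : status -> state -> Prop :=
| run_start : run alg s0 Running s0
| run_iter s s' :
    run alg s0 Running s -> queue s != set0 -> main_iter alg s true s' ->
    run alg s0 Running s'
| run_failure s s' :
    run alg s0 Running s -> queue s != set0 -> main_iter alg s false s' ->
    run alg s0 Failure s'
| run_success s :
    run alg s0 Running s -> queue s = set0 -> run alg s0 Success s.

Definition init_state : state :=
  State (fun x => iota 1 (dsize x)) (fun _ => NIL) (fun _ => NIL) set0 0.

Definition assign (x : var) (a : value) (s : state) : state :=
  set_queue [set x] (set_dom [eta dom s with x |-> [:: a]] s).

(* [node alg A s]: s is the state at a node of the search tree where the
   variables in A have been assigned one after the other, each assignment being
   followed by a successful invocation of the algorithm. As a new variable is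
   assigned at each step, there are at most [nvar P] invocations on a branch. *)
Inductive node (alg : algorithm) : {set var} -> state -> Prop :=
| node_root : node alg set0 init_state
| node_child A s x a s' :
    node alg A s -> x \notin A -> a \in dom s x ->
    run alg (assign x a s) Success s' -> node alg (x |: A) s'.

(* [invocation alg s s']: s is a node of the search tree, and s' is reached from
   it by a further assignment and a (possibly failing) invocation. *)
Definition invocation (alg : algorithm) (s s' : state) : Prop :=
  exists (A : {set var}) (x : var) (a : value) (st : status),
    [/\ node alg A s, x \notin A, a \in dom s x & run alg (assign x a s) st s'].

End Algorithm.

(* A time complexity is given by the numbers of checks [T n e d t] which are
   attained with parameters n, e, d; its worst case is their supremum. *)
Definition complexity := nat -> nat -> nat -> nat -> Prop.

Definition node_time (alg : algorithm) : complexity := fun n e d t =>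
  exists P : csp, [/\ nvar P = n, nconstr P = e, maxdom P = d &
    exists s s' : state P, invocation alg s s' /\ checks s' = checks s + t].

(* The counter starts at 0 at the root, so that [checks s'] is the total over
   all the invocations of the branch. *)
Definition branch_time (alg : algorithm) : complexity := fun n e d t =>
  exists P : csp, [/\ nvar P = n, nconstr P = e, maxdom P = d &
    exists s s' : state P, invocation alg s s' /\ checks s' = t].

Definition bigO (T : complexity) (f : nat -> nat -> nat -> nat) : Prop :=
  exists c : nat, forall n e d t, T n e d t -> t <= c * f n e d.

(* Main.v *)
Require Import Defs.
From mathcomp Require Import all_boot zify.

(* Amortized analysis along a branch, in which the LastAC pointers play no role:
   every search for a PC-witness of a given pair of values in one D(z) costs at
   most 2 + 4d checks even if the two AC-supports are sought from scratch.

   - The pointer LastPC(x, a, y) only moves forward, past every value of D(y)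
     tried so far, and if the search for its next value fails then a is deleted.
     So each of the d values of D(y) is tried at most once, for a cost of at most
     1 + n(2 + 4d).
   - The remaining checks are those of the first part of checkPCwit, at most
     n(2 + 4d) for each visit of a value of x when y is taken from the queue. As
     y enters the queue only when it is assigned or when D(y) loses a value, this
     happens at most d + 1 times.

   Both are expressed by credits whose sum with the number of checks never
   increases, except by a fixed amount at each assignment. *)

Set Implicit Arguments.
Unset Strict Implicit.
Unset Printing Implicit Defensive.

Section Complexity.

Variable P : csp.

Notation n := (nvar P).
Notation d := (maxdom P).
Notation var := 'I_n.
Notation domains := (var -> seq nat).

Implicit Types (x y z : var) (a b : nat) (s : state P) (D : domains).

(** * Programs that move only the LastAC pointers: worst-case number of checks *)

Definition quiet_step k s s' :=
  [/\ dom s' = dom s, lastPC s' = lastPC s, queue s' = queue s &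
      checks s' <= checks s + k].

Lemma quiet_step_trans k1 k2 s1 s2 s3 :
  quiet_step k1 s1 s2 -> quiet_step k2 s2 s3 -> quiet_step (k1 + k2) s1 s3.
Proof.
move=> [d12 p12 q12 c12] [d23 p23 q23 c23].
split; [by rewrite d23|by rewrite p23|by rewrite q23|lia].
Qed.

Lemma quiet_step_weaken k k' s s' :
  k <= k' -> quiet_step k s s' -> quiet_step k' s s'.
Proof. by move=> le_kk' [? ? ? ?]; split=> //; lia. Qed.

(** Fixing the domains [D] beforehand lets the length of every loop over a current domain be bounded
    before the program runs. *)
Definition quiet D k A (m : prog P A) :=
  forall s r s', m s r s' -> dom s = D -> quiet_step k s s'.

Section Quiet.

Variable D : domains.

Lemma quiet_weaken k k' A (m : prog P A) :
  k <= k' -> quiet D k m -> quiet D k' m.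
Proof. by move=> le_kk' mP s r s' /mP sP /sP; apply: quiet_step_weaken. Qed.

Lemma quiet_ret k A (r : A) : quiet D k (@ret P A r).
Proof. by move=> s r' s' [_ ->] _; split=> //; lia. Qed.

Lemma quiet_gets k A (f : state P -> A) : quiet D k (gets f).
Proof. by move=> s r' s' [_ ->] _; split=> //; lia. Qed.

Lemma quiet_bind k1 k2 A B (m : prog P A) (f : A -> prog P B) :
  quiet D k1 m -> (forall r, quiet D k2 (f r)) -> quiet D (k1 + k2) (bind m f).
Proof.
move=> mP fP s r s' [t [s1 [/mP m1 /fP f1]]] sD.
have s1P := m1 sD; apply: quiet_step_trans (s1P) (f1 _).
by case: s1P => ->.
Qed.

Lemma quiet_bind_gets k A B (g : state P -> A) (f : A -> prog P B) :
  (forall s, dom s = D -> quiet D k (f (g s))) -> quiet D k (bind (gets g) f).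
Proof. by move=> fP s r s' [_ [_ [[-> ->] fs]]] sD; apply: (fP s sD _ _ _ fs). Qed.

Lemma quiet_if k (c : bool) A (m1 m2 : prog P A) :
  quiet D k m1 -> quiet D k m2 -> quiet D k (if c then m1 else m2).
Proof. by case: c. Qed.

Lemma quiet_orM k1 k2 (m1 m2 : prog P bool) :
  quiet D k1 m1 -> quiet D k2 m2 -> quiet D (k1 + k2) (orM m1 m2).
Proof.
by move=> m1P m2P; apply: quiet_bind => // r; apply: quiet_if => //; apply: quiet_ret.
Qed.

Lemma quiet_andM k1 k2 (m1 m2 : prog P bool) :
  quiet D k1 m1 -> quiet D k2 m2 -> quiet D (k1 + k2) (andM m1 m2).
Proof.
by move=> m1P m2P; apply: quiet_bind => // r; apply: quiet_if => //; apply: quiet_ret.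
Qed.

Lemma quiet_hasM k T (f : T -> prog P bool) r :
  (forall t, quiet D k (f t)) -> quiet D (size r * k) (hasM f r).
Proof.
move=> fP; elim: r => [|t r IHr] /=; first exact: quiet_ret.
by rewrite mulSn; apply: quiet_orM.
Qed.

Lemma quiet_allM k T (f : T -> prog P bool) r :
  (forall t, quiet D k (f t)) -> quiet D (size r * k) (allM f r).
Proof.
move=> fP; elim: r => [|t r IHr] /=; first exact: quiet_ret.
by rewrite mulSn; apply: quiet_andM.
Qed.

Lemma quiet_isConsistent x a y b : quiet D 1 (isConsistent x a y b).
Proof. by move=> s r s' [_ [_ [-> [_ ->]]]] _; split=> //=; lia. Qed.

Lemma quiet_setAC x a y b : quiet D 0 (setAC x a y b).
Proof. by move=> s r s' -> _; split=> //=; lia. Qed.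

Hypothesis size_D : forall x, size (D x) <= d.

Lemma quiet_seekACsupport x a z : quiet D d (seekACsupport x a z).
Proof.
apply: quiet_bind_gets => s _; apply: quiet_bind_gets => s' ->.
apply: quiet_if; first exact: quiet_ret.
apply: (@quiet_weaken (size [seq c <- D z | lastAC s (x, a, z) < c] * 1)).
  by rewrite muln1 size_filter (leq_trans (count_size _ _)).
apply: quiet_hasM => c; rewrite -[1]/(1 + (0 + 0)).
apply: quiet_andM; first exact: quiet_isConsistent.
by apply: quiet_bind => [|_]; [apply: quiet_setAC|apply: quiet_ret].
Qed.

Lemma quiet_lastAC_is_witness x a y b z :
  quiet D 1 (lastAC_is_witness x a y b z).
Proof.
apply: quiet_bind_gets => s _; apply: quiet_bind_gets => s' _.
by apply: quiet_if; [apply: quiet_isConsistent|apply: quiet_ret].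
Qed.

Lemma quiet_findPCwit x a y b z : quiet D (2 + 4 * d) (findPCwit x a y b z).
Proof.
(* One check per LastAC shortcut, [d] per AC-support sought, and two per candidate witness. *)
have -> : 2 + 4 * d = (1 + 1) + ((d + d) + d * 2) by lia.
apply: quiet_orM; first by apply: quiet_orM; apply: quiet_lastAC_is_witness.
apply: quiet_andM; first by apply: quiet_andM; apply: quiet_seekACsupport.
apply: quiet_bind_gets => s1 _; apply: quiet_bind_gets => s2 _.
apply: quiet_bind_gets => s3 ->.
set r := [seq c <- D z | _].
apply: (@quiet_weaken (size r * 2)).
  by rewrite leq_mul2r size_filter (leq_trans (count_size _ _)).
apply: quiet_hasM => c; rewrite -[2]/(1 + 1).
by apply: quiet_andM; apply: quiet_isConsistent.
Qed.

Lemma size_any_order (V : pred var) (r : seq var) :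
  perm_eq r (enum V) -> size r <= n.
Proof.
by move=> /perm_size ->; rewrite -cardE (leq_trans (max_card _)) // card_ord.
Qed.

Definition witness_cost := n * (2 + 4 * d).

Lemma quiet_searchPCwit x a y b : quiet D witness_cost (searchPCwit x a y b).
Proof.
move=> s r s' [l [_ [[/size_any_order le_ln ->] ls]]] sD.
apply: (quiet_step_weaken (k := size l * (2 + 4 * d))).
  by rewrite leq_mul2r le_ln orbT.
by apply: quiet_allM ls sD => z; apply: quiet_findPCwit.
Qed.

End Quiet.

(** * Well-formed domains and the credit of a value *)

Definition wf D := forall x, subseq (D x) (iota 1 (dsize x)).

Lemma wf_size D x : wf D -> size (D x) <= d.
Proof.
move=> /(_ x) /size_subseq; rewrite size_iota => /leq_trans; apply.
exact: (leq_bigmax_cond (F := @dsize P)).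
Qed.

Lemma wf_sorted D x : wf D -> sorted ltn (D x).
Proof.
move=> /(_ x) /(subseq_sorted ltn_trans); apply; exact: iota_ltn_sorted.
Qed.

Lemma wf_uniq D x : wf D -> uniq (D x).
Proof. by move=> /(_ x) /subseq_uniq; apply; apply: iota_uniq. Qed.

Lemma wf_le D x a : wf D -> a \in D x -> a <= d.
Proof.
move=> /(_ x) /mem_subseq sD /sD; rewrite mem_iota add1n ltnS => /andP [_].
by move/leq_trans; apply; apply: (leq_bigmax_cond (F := @dsize P)).
Qed.

(** Bounds the number of values still ahead of the LastPC pointers of [(x, a)]. Only neighbours of
    [x] count, so that the sum over [x] brings in the number of constraints and not the square of
    [n]. *)
Definition pc_left s x a :=
  \sum_(y | constrained x y) (d - lastPC s (x, a, y)).

Lemma eq_pc_left s s' x a :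
  (forall y, lastPC s' (x, a, y) = lastPC s (x, a, y)) ->
  pc_left s' x a = pc_left s x a.
Proof. by move=> eq_pc; apply: eq_bigr => y _; rewrite eq_pc. Qed.

Definition PCsup_cost := witness_cost.+1.

(** * Amortized cost of the searches for PC-supports and witnesses *)

Section Amortized.

Variables (D : domains) (wfD : wf D).

Let size_D x : size (D x) <= d := wf_size x wfD.

(* [d - c] truncates to 0 beyond d, so that no bound on the pointers has to be
   carried along. A failure exhausts the credit of (x, a): it is followed by the
   deletion of a. *)
Definition amortized x a k (m : prog P bool) :=
  forall s (ok : bool) s', m s ok s' -> dom s = D ->
  [/\ dom s' = D, queue s' = queue s,
      (forall x' a' y', (x', a') != (x, a) ->
         lastPC s' (x', a', y') = lastPC s (x', a', y')) &
      checks s' + ok * (PCsup_cost * pc_left s' x a) <=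
        checks s + PCsup_cost * pc_left s x a + k].

Lemma amortized_weaken x a k k' m :
  k <= k' -> amortized x a k m -> amortized x a k' m.
Proof.
by move=> le_kk' mP s ok s' /mP sP /sP [? ? ? ?]; split=> //; lia.
Qed.

Lemma quiet_amortized x a k (m : prog P bool) :
  quiet D k m -> amortized x a k m.
Proof.
move=> mP s ok s' /mP sP sD; have [dE pE qE le_c] := sP sD.
split=> //; first by rewrite dE.
  by move=> *; rewrite pE.
rewrite (@eq_pc_left s s'); first by case: ok => /=; lia.
by move=> y; rewrite pE.
Qed.

Lemma amortized_andM x a k1 k2 m1 m2 :
  amortized x a k1 m1 -> amortized x a k2 m2 ->
  amortized x a (k1 + k2) (andM m1 m2).
Proof.
move=> m1P m2P s ok s' [ok1 [s1 [/m1P m1s m2s]]] sD.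
have [d1 q1 p1 c1] := m1s sD; case: ok1 {m1s} m2s c1 => [/m2P m2s|[-> ->]] c1.
  have [d2 q2 p2 c2] := m2s d1.
  split=> //; first by rewrite q2.
    by move=> x' a' y' neq; rewrite p2 ?p1.
  by move: c1 c2; rewrite mul1n; lia.
by split=> //; move: c1; lia.
Qed.

(** The first operand must be quiet: an amortized program may use up the credit when it fails,
    leaving nothing to pay for the second one. In a conjunction the second operand runs only after a
    success, which preserves the accounting. *)
Lemma amortized_orM x a k1 k2 m1 m2 :
  quiet D k1 m1 -> amortized x a k2 m2 ->
  amortized x a (k1 + k2) (orM m1 m2).
Proof.
move=> m1P m2P s ok s' [ok1 [s1 [m1s m2s]]] sD.
case: ok1 m2s m1s => [[-> ->]|/m2P m2s] m1s.
  apply: (@quiet_amortized x a (k1 + k2) m1) m1s sD.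
  by apply: quiet_weaken m1P; lia.
have [d1 p1 q1 c1] := m1P _ _ _ m1s sD.
have [] := m2s; first by rewrite d1.
move=> d2 q2 p2 c2; split=> //; first by rewrite q2.
  by move=> x' a' y' neq; rewrite p2 ?p1.
have pE : pc_left s1 x a = pc_left s x a by apply: eq_pc_left => y; rewrite p1.
by move: c2; rewrite pE; lia.
Qed.

Lemma amortized_allM x a k (T : eqType) (f : T -> prog P bool) r :
  {in r, forall t, amortized x a k (f t)} ->
  amortized x a (size r * k) (allM f r).
Proof.
elim: r => [|t r IHr] fP /=; first exact/quiet_amortized/quiet_ret.
rewrite mulSn; apply: amortized_andM; first by apply: fP; rewrite mem_head.
by apply: IHr => u ru; apply: fP; rewrite inE ru orbT.
Qed.

Definition PCsup_body x a y b : prog P bool :=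
  andM (isConsistent x a y b)
    (bind (gets (fun s => (lastAC s (x, a, y) \notin dom s y)
                          && (lastPC s (x, a, y) < lastAC s (x, a, y))))
      (fun stale : bool =>
        bind (if stale then setAC x a y b else @ret P unit tt)
          (fun _ => andM (searchPCwit x a y b)
                      (bind (setPC x a y b) (fun _ => @ret P bool true))))).

(** The LastPC pointer moves only in the very last action, so a trial is quiet up to that update. *)
Lemma PCsup_bodyP x a y b s ok s' :
  PCsup_body x a y b s ok s' -> dom s = D ->
  exists2 s1, quiet_step PCsup_cost s s1 &
    s' = if ok then set_lastPC [eta lastPC s1 with (x, a, y) |-> b] s1 else s1.
Proof.
move=> [ok1 [s1 [/(@quiet_isConsistent D) c1 rest]]] /[dup] sD /c1 {}c1.
case: ok1 rest => [|[-> ->]]; last first.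
  by exists s1 => //; apply: quiet_step_weaken c1.
move=> [stale [_ [[_ ->] [u [s2 [ac rest]]]]]].
have {}c1 : quiet_step (1 + 0) s s2.
  apply: quiet_step_trans (c1) _.
  apply: (@quiet_if D 0 _ _ (setAC x a y b) (@ret P unit tt)) ac _.
  - exact: quiet_setAC.
  - exact: quiet_ret.
  - by case: c1 => ->.
have d2 : dom s2 = D by case: c1 => ->.
case: rest => ok2 [s3 [/(quiet_searchPCwit size_D)/(_ d2) c3 rest]].
have {}c3 : quiet_step PCsup_cost s s3 by apply: quiet_step_trans c1 c3.
case: ok2 rest => [[_ [_ [-> [-> ->]]]]|[-> ->]]; by exists s3.
Qed.

(** The candidates are strictly increasing integers above [l], so at most [c - l] of them are tried
    up to [c], and at most [d - l] in all. *)
Lemma PCsup_loopP x a y l r s ok s' :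
    hasM (PCsup_body x a y) r s ok s' -> dom s = D -> path ltn l r ->
    all (leq^~ d) r ->
  if ok then exists c s1,
      [/\ l < c <= d, s' = set_lastPC [eta lastPC s1 with (x, a, y) |-> c] s1 &
          quiet_step (PCsup_cost * (c - l)) s s1]
  else quiet_step (PCsup_cost * (d - l)) s s'.
Proof.
elim: r l s => [|b r IHr] l s /=.
  by move=> [-> ->] *; split=> //; apply: leq_addr.
move=> [ok1 [s1 [body rest]]] sD /andP [lt_lb b_r] /andP [le_bd le_rd].
have [s2 q2 s1E] := PCsup_bodyP body sD; case: ok1 rest s1E {body} => [|rest].
  move=> [-> ->] ->; exists b, s2; split=> //; first by rewrite lt_lb.
  by apply: quiet_step_weaken q2; rewrite leq_pmulr // subn_gt0.
move=> E; rewrite {s1}E in rest.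
have d2 : dom s2 = D by case: q2 => ->.
have := IHr _ _ rest d2 b_r le_rd; case: ok {rest IHr} => [[c [s3 [bc -> q3]]]|q3].
  exists c, s3; split=> //; first by lia.
  apply: quiet_step_weaken (quiet_step_trans q2 q3).
  by rewrite -mulnS leq_mul2l; lia.
apply: quiet_step_weaken (quiet_step_trans q2 q3).
by rewrite -mulnS leq_mul2l; lia.
Qed.

Lemma amortized_nextPCsup x a y :
  constrained x y -> amortized x a 0 (nextPCsup x a y).
Proof.
move=> Cxy s ok s' [_ [_ [[-> ->] [_ [_ [[-> ->] [_ [_ [[-> ->]]]]]]]]]] loop sD.
set l := lastPC s (x, a, y).
move: loop; rewrite -/l; set start := (if _ then _ else _) => loop.
have lt_l : l < start by rewrite /start; case: ifP => _; rewrite leq_max leqnn.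
have pathr : path ltn l [seq b <- dom s y | start <= b].
  rewrite path_sortedE; last exact: ltn_trans.
  apply/andP; split.
    by apply/allP => b; rewrite mem_filter => /andP [/(leq_trans lt_l)].
  by apply: sorted_filter; [exact: ltn_trans|rewrite sD; apply: wf_sorted].
have ler : all (leq^~ d) [seq b <- dom s y | start <= b].
  by apply/allP => b; rewrite mem_filter sD => /andP [_]; apply: wf_le.
(* This single term of the credit pays for a failing search. *)
have le_pc : d - l <= pc_left s x a.
  by rewrite /pc_left (bigD1 y) //= -/l leq_addr.
have := PCsup_loopP loop sD pathr ler; case: ok {loop} => [[c [s1 [lc -> q]]]|q].
  case: q => dE pE qE le_c; split=> //=; first by rewrite dE.
    move=> x' a' y' neq; rewrite ifF ?pE //.
    by apply: contraNF neq => /eqP [-> -> _].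
  rewrite mul1n addn0.
  (* Only the term of [y] changes; as [l < c <= d], no truncation occurs and moving the pointer from
     [l] to [c] releases exactly [c - l]. *)
  have -> : pc_left s x a = pc_left (set_lastPC
      [eta lastPC s1 with (x, a, y) |-> c] s1) x a + (c - l).
    rewrite /pc_left (bigD1 y) //= [in RHS](bigD1 y) //= eqxx -/l.
    rewrite [in RHS](eq_bigr (fun z => d - lastPC s (x, a, z))); first by lia.
    move=> z /andP [_ neq_zy]; rewrite ifF ?pE //.
    by apply: contraNF neq_zy => /eqP [->].
  by rewrite mulnDr addnCA addnC leq_add2l.
case: q => dE pE qE le_c; split=> //; first by rewrite dE.
  by move=> *; rewrite pE.
rewrite mul0n !addn0 (leq_trans le_c) // leq_add2l.
by rewrite leq_mul2l le_pc orbT.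
Qed.

Lemma amortized_searchPCsup x a y :
  constrained x y -> amortized x a 0 (searchPCsup x a y).
Proof.
move=> Cxy; rewrite -[0]/(0 + 0); apply: amortized_orM; first exact: quiet_gets.
exact: amortized_nextPCsup.
Qed.

(** Only the first part is charged, once for each [z]; the second part is a search for a next
    PC-support and is paid by the credit of [(x, a)]. *)
Lemma amortized_checkPCwit x a y :
  amortized x a witness_cost (checkPCwit x a y).
Proof.
move=> s ok s' [r [_ [[perm_r ->] all_r]]] sD.
have le_r := size_any_order perm_r.
apply: (@amortized_weaken x a (size r * (2 + 4 * d))) all_r sD.
  by rewrite leq_mul2r le_r orbT.
apply: amortized_allM => z.
rewrite (perm_mem perm_r) mem_enum => /andP [Cxz _] {s' ok perm_r r le_r}.
rewrite -[2 + 4 * d]addn0 => s1 ok s' [_ [_ [[-> ->] [_ [_ [[-> ->] or_z]]]]]] sD.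
apply: (@amortized_orM x a (2 + 4 * d) 0) or_z sD.
  by apply: quiet_if; [apply: quiet_findPCwit|apply: quiet_ret].
case: ifP => _; first exact: amortized_nextPCsup.
exact/quiet_amortized/quiet_ret.
Qed.

Lemma amortized_supported alg x a y :
  constrained x y -> amortized x a witness_cost (supported alg x a y).
Proof.
move=> Cxy; case: alg => /=.
  rewrite -[witness_cost]add0n; apply: amortized_andM.
    exact: amortized_searchPCsup.
  exact: amortized_checkPCwit.
apply: (@amortized_weaken x a 0); first exact: leq0n.
exact: amortized_searchPCsup.
Qed.

End Amortized.

(** * The potential and its evolution in the main loop *)

Definition degree y := #|[set x | constrained x y]|.

(** Bounds the checks not paid by LastPC credits when [y] is taken from the queue: each value of
    each neighbour may cost [witness_cost]. *)
Definition visit_cost y := degree y * (d * witness_cost).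

(** Only current values hold credit, so a deletion discards the credit that the failed search has
    used up. *)
Definition PC_credit s := \sum_x \sum_(a <- dom s x) pc_left s x a.

(** Each remaining value of [y] prepays the visit that its deletion may trigger; a pending visit is
    counted by the membership of [y] in the queue. *)
Definition queue_credit s :=
  \sum_y (size (dom s y) + (y \in queue s)) * visit_cost y.

Definition total s := checks s + PCsup_cost * PC_credit s + queue_credit s.

Definition revise_value alg x y a : prog P unit :=
  bind (supported alg x a y)
    (fun ok => if ok then @ret P unit tt else delete x a).

(** The last conclusion serves the loop of [revise], which runs over the domain as it was at the
    start: values still to be visited have not been deleted. *)
Lemma revise_valueP alg x y a s u s' :
    revise_value alg x y a s u s' -> constrained x y -> wf (dom s) ->
    a \in dom s x ->
  [/\ wf (dom s'), total s' <= total s + witness_cost &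
      forall b, b \in dom s x -> b != a -> b \in dom s' x].
Proof.
move=> [ok [s1 [sup rest]]] Cxy wfs sa.
have [dE qE pE le_c] := amortized_supported wfs Cxy sup (erefl _).
have uniq_x := wf_uniq x wfs.
set other := \sum_(b <- rem a (dom s x)) pc_left s x b.
set others := \sum_(x' | x' != x) \sum_(b <- dom s x') pc_left s x' b.
have otherE : \sum_(b <- rem a (dom s x)) pc_left s1 x b = other.
  apply: eq_big_seq => b; rewrite mem_rem_uniq // inE => /andP [neq_ba _].
  by apply: eq_pc_left => z; apply: pE; apply: contra neq_ba => /eqP [->].
have othersE :
    \sum_(x' | x' != x) \sum_(b <- dom s x') pc_left s1 x' b = others.
  apply: eq_bigr => x' neq_x; apply: eq_bigr => b _.
  by apply: eq_pc_left => z; apply: pE; apply: contra neq_x => /eqP [->].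
have creditE : PC_credit s = pc_left s x a + other + others.
  by rewrite /PC_credit (bigD1 x) //= (big_rem a).
case: ok rest le_c {sup} => [[_ ->]|[_ [_ [-> ->]]]] le_c.
  rewrite dE; split=> //.
  rewrite /total creditE.
  have -> : queue_credit s1 = queue_credit s by rewrite /queue_credit dE qE.
  have -> : PC_credit s1 = pc_left s1 x a + other + others.
    by rewrite /PC_credit dE (bigD1 x) //= (big_rem a) //= otherE othersE.
  by move: le_c; rewrite mul1n !mulnDr; lia.
split.
- move=> z /=; rewrite dE; case: eqP => [->|_]; last exact: wfs.
  exact: subseq_trans (rem_subseq _ _) (wfs x).
- set s2 := set_queue _ _.
  have PC2 : PC_credit s2 = other + others.
    rewrite /PC_credit (bigD1 x) //= eqxx dE -otherE -othersE; congr (_ + _).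
    by apply: eq_bigr => x' /negPf ->.
  (* The domain of [x] loses one value, which compensates for [x] entering the queue. *)
  have Q2 : queue_credit s2 <= queue_credit s.
    rewrite /queue_credit (bigD1 x) //= [leqRHS](bigD1 x) //= eqxx dE.
    rewrite leq_add //.
      rewrite leq_mul2r size_rem // !inE eqxx /=.
      by case: (dom s x) sa => //= *; lia.
    by apply: leq_sum => y' /negPf neq; rewrite neq !inE neq qE.
  rewrite /total PC2 creditE /=.
  by move: le_c; rewrite mul0n !mulnDr; lia.
by move=> b sb neq_ba /=; rewrite eqxx dE mem_rem_uniq // inE neq_ba.
Qed.

Lemma revise_valuesP alg x y r s u s' :
    eachM (revise_value alg x y) r s u s' -> constrained x y -> wf (dom s) ->
    uniq r -> {subset r <= dom s x} ->
  wf (dom s') /\ total s' <= total s + size r * witness_cost.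
Proof.
move=> each_r Cxy; elim: r s u each_r => [|a r IHr] s u /=.
  by move=> [_ ->] wfs; split=> //; apply: leq_addr.
move=> [u1 [s1 [rev_a rev_r]]] wfs /andP [ra uniq_r] sub.
have [wfs1 le1 dom1] := revise_valueP rev_a Cxy wfs (sub a (mem_head _ _)).
have [||wfs' le'] := IHr _ _ rev_r wfs1 => //.
  move=> b rb; apply: dom1; first by apply: sub; rewrite inE rb orbT.
  by apply: contraNneq ra => <-.
by split=> //; rewrite mulSn; lia.
Qed.

Lemma reviseP alg x y s u s' :
    revise alg x y s u s' -> constrained x y -> wf (dom s) ->
  wf (dom s') /\ total s' <= total s + d * witness_cost.
Proof.
move=> [_ [_ [[-> ->] each_r]]] Cxy wfs.
have [] := revise_valuesP each_r Cxy wfs (wf_uniq x wfs); first by [].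
move=> wfs' /leq_trans le_t; split=> //; apply: le_t.
by rewrite leq_add2l leq_mul2r wf_size ?orbT.
Qed.

Lemma main_iterP alg s ok s' :
  main_iter alg s ok s' -> wf (dom s) -> wf (dom s') /\ total s' <= total s.
Proof.
move=> [_ [_ [[-> ->] [y [_ [[sy ->] [u [s1 [s1E rest]]]]]]]]].
case: rest => r [_ [[perm_r ->] all_r]] wfs.
(* Taking [y] from the queue releases the budget for all the revisions against [y]. *)
have total1 : total s1 + visit_cost y = total s.
  rewrite s1E /total /= -addnA; congr (_ + _).
  rewrite /queue_credit (bigD1 y) //= [RHS](bigD1 y) //= !inE eqxx sy.
  rewrite (eq_bigr (fun z => (size (dom s z) + (z \in queue s)) * visit_cost z)).
    by rewrite /= addn0 addn1 mulSn addnC addnA.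
  by move=> z neq; rewrite !inE neq.
have size_r : size r = degree y.
  by rewrite (perm_size perm_r) -cardE /degree cardsE.
have {perm_r} : {in r, forall x, constrained x y}.
  by move=> x; rewrite (perm_mem perm_r) mem_enum.
have {wfs s1E} : wf (dom s1) by rewrite s1E.
suff: wf (dom s1) -> {in r, forall x, constrained x y} ->
    wf (dom s') /\ total s' <= total s1 + size r * (d * witness_cost).
  move=> H w /(H w) [? le_t]; split=> //.
  by move: le_t; rewrite -total1 size_r.
move: all_r {total1 size_r}; elim: r s1 => [|x r IHr] s1.
  by move=> [_ ->] *; split=> //; lia.
move=> [ok1 [s2 [[w [s3 [rev [_ ->]]]] rest]]] wf1 Cr.
have [wf3 le3] := reviseP rev (Cr x (mem_head _ _)) wf1.
case: ok1 rest => [/IHr/(_ wf3) H|[_ ->]]; last first.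
  by split=> //=; rewrite mulSn; lia.
have [|wf' le'] := H; first by move=> z rz; apply: Cr; rewrite inE rz orbT.
by split=> //=; rewrite mulSn; lia.
Qed.

(** * Invocations and branches of the search tree *)

Lemma runP alg s st s' :
  run alg s st s' -> wf (dom s) -> wf (dom s') /\ total s' <= total s.
Proof.
move=> r wfs; elim: r => // s1 s2 _ [wf1 le1] _ it;
by have [? le2] := main_iterP it wf1; split=> //; apply: leq_trans le1.
Qed.

(** The domain of [x] is nonempty beforehand and a singleton afterwards, so only the entry of [x]
    into the queue can raise the potential. *)
Lemma assignP x a s :
    wf (dom s) -> a \in dom s x ->
  wf (dom (assign x a s)) /\ total (assign x a s) <= total s + visit_cost x.
Proof.
move=> wfs sa; split.
  move=> z /=; case: eqP => [->|_]; last exact: wfs.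
  by apply: subseq_trans (wfs x); rewrite sub1seq.
have le_PC : PC_credit (assign x a s) <= PC_credit s.
  apply: leq_sum => z _ /=.
  case: eqP => [->|_] //; rewrite big_seq1 [leqRHS](big_rem a) //=.
  exact: leq_addr.
have le_Q : queue_credit (assign x a s) <= queue_credit s + visit_cost x.
  rewrite /queue_credit (bigD1 x) //= [X in _ <= X + _](bigD1 x) //= !inE eqxx.
  rewrite addnAC leq_add //.
    rewrite -mulSnr leq_mul2r; apply/orP; right.
    by case: (dom s x) sa => //= *; lia.
  by apply: leq_sum => z /negPf neq; rewrite neq !inE neq addn0 mulnDl leq_addr.
have := leq_mul (leqnn PCsup_cost) le_PC.
by rewrite /total /=; lia.
Qed.

(** Assigned variables are distinct, hence the surcharges of the assignments add up to a sum over
    the set [A]. *)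
Lemma nodeP alg (A : {set var}) s :
    node alg A s ->
  wf (dom s) /\
    total s <= total (init_state P) + \sum_(x in A) visit_cost x.
Proof.
elim=> {A s} [|A s x a s' _ [wfs le_s] Ax sa r].
  by split; [move=> x /=|rewrite leq_addr].
have [wf1 le1] := assignP wfs sa; have [wf2 le2] := runP r wf1.
split=> //; rewrite big_setU1 //=.
by apply: leq_trans le2 (leq_trans le1 _); rewrite addnCA addnC leq_add2l.
Qed.

(** * Bounds in terms of the parameters of the CSP *)

Lemma sum_degree : \sum_x degree x = 2 * nconstr P.
Proof.
(* Double counting: ordered constrained pairs split into increasing and decreasing ones, exchanged
   by swapping components. *)
pose up := [set p : var * var | (p.1 < p.2) && constrained p.1 p.2].
pose down := [set p : var * var | (p.2 < p.1) && constrained p.1 p.2].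
have -> : \sum_x degree x = #|up :|: down|.
  under eq_bigr do rewrite /degree -sum1_card.
  rewrite pair_big_dep /= -sum1_card (reindex (fun p : var * var => (p.2, p.1))).
    apply: eq_bigl => -[x y]; rewrite !inE /=.
    rewrite -andb_orl -neq_ltn val_eqE; case: eqP => //= ->.
    by rewrite constrained_irr.
  by exists (fun p : var * var => (p.2, p.1)) => -[].
have /eqP : #|up :&: down| = 0.
  by apply: eq_card0 => -[x y]; rewrite !inE /=; case: ltngtP; rewrite /= ?andbF.
have -> : down = (fun p : var * var => (p.2, p.1)) @: up.
  apply/setP => -[x y]; apply/idP/imsetP => [|[[u v]]].
    by rewrite inE /= => H; exists (y, x); rewrite ?inE //= constrained_sym.
  by rewrite !inE /= constrained_sym => H [-> ->].
rewrite cards_eq0 cardsU => /eqP ->; rewrite cards0 subn0 card_imset.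
  by rewrite /nconstr -/up; lia.
by move=> [x y] [u v] [-> ->].
Qed.

Lemma total_init :
  total (init_state P) <= 2 * nconstr P * (d * d * (PCsup_cost + witness_cost)).
Proof.
have le_d x : dsize x <= d by apply: (leq_bigmax_cond (F := @dsize P)).
have le_PC : PC_credit (init_state P) <= 2 * nconstr P * (d * d).
  rewrite -sum_degree big_distrl /=; apply: leq_sum => x _.
  have left_x a : pc_left (init_state P) x a = degree x * d.
    rewrite /pc_left /= sum_nat_cond_const subn0; congr (_ * _).
    by apply: eq_card => y; rewrite !inE constrained_sym.
  under eq_bigr do rewrite left_x.
  rewrite big_const_seq count_predT size_iota iter_addn_0.
  by rewrite -mulnA leq_mul2l leq_mul2l le_d !orbT.
have le_Q : queue_credit (init_state P) <=
    2 * nconstr P * (d * d * witness_cost).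
  rewrite -sum_degree big_distrl /=; apply: leq_sum => x _.
  rewrite size_iota inE addn0 /visit_cost mulnCA leq_mul2l; apply/orP; right.
  by rewrite -mulnA leq_mul2r le_d orbT.
have := leq_mul (leqnn PCsup_cost) le_PC.
by rewrite /total -[checks _]/0; lia.
Qed.

Lemma invocation_checks alg s s' :
  invocation alg s s' -> checks s' <= 38 * (nconstr P * n * d ^ 3).
Proof.
move=> [A [x [a [st [nodes Ax sa r]]]]].
have [wfs le_s] := nodeP nodes.
have [wf1 le1] := assignP wfs sa; have [wf2 le2] := runP r wf1.
(* Positivity of [n] and [d], given by the assigned variable and value, lets lower-order terms be
   absorbed into [n * d]. *)
have n_gt0 : 0 < n by apply: leq_ltn_trans (ltn_ord x).
have d_gt0 : 0 < d.
  by have := wf_size x wfs; apply: leq_trans; case: (dom s x) sa.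
have visits : \sum_(z in A) visit_cost z + visit_cost x <=
    2 * nconstr P * (d * witness_cost).
  rewrite addnC -(big_setU1 _ Ax) -sum_degree big_distrl /=.
  rewrite [leqRHS](bigID (mem (x |: A))) /=; exact: leq_addr.
have le_init := total_init.
have le_w : witness_cost <= 6 * (n * d).
  by rewrite /witness_cost mulnCA leq_mul2l; lia.
have le_pc : PCsup_cost <= 7 * (n * d).
  have : 0 < n * d by rewrite muln_gt0 n_gt0.
  by rewrite /PCsup_cost; lia.
have le_ch : checks s' <= total s' by rewrite /total -addnA leq_addr.
have le_all : checks s' <= 2 * nconstr P *
    (d * d * (PCsup_cost + witness_cost) + d * witness_cost).
  by lia.
apply: (leq_trans le_all).
(* Here 38 is [2 * (13 + 6)]: 13 = 7 + 6 from the initial potential, and 6 from the assignments,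
   whose factor [d] is relaxed to [d * d]. *)
have -> : 38 * (nconstr P * n * d ^ 3) =
    2 * nconstr P * (d * d * (13 * (n * d)) + d * d * (6 * (n * d))).
  by rewrite !expnS expn0; lia.
rewrite leq_mul2l; apply/orP; right; apply: leq_add.
  by rewrite leq_mul2l; apply/orP; right; lia.
by apply: leq_mul => //; rewrite leq_pmulr.
Qed.

End Complexity.

Lemma branch_time_bigO alg : bigO (branch_time alg) (fun n e d => e * n * d ^ 3).
Proof.
exists 38 => n e d t [P [<- <- <- [s [s' [inv <-]]]]].
exact: invocation_checks inv.
Qed.

(** The checks of one invocation are among those of the whole branch leading to it, so the branch
    bound applies. *)
Lemma node_time_bigO alg : bigO (node_time alg) (fun n e d => e * n * d ^ 3).
Proof.
exists 38 => n e d t [P [<- <- <- [s [s' [inv eq_t]]]]].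
by apply: leq_trans (invocation_checks inv); rewrite eq_t leq_addl.
Qed.

Theorem proposition3 :
  [/\ bigO (node_time maxRPC3) (fun n e d => e * n * d ^ 3),
      bigO (branch_time maxRPC3) (fun n e d => e * n * d ^ 3),
      bigO (node_time lmaxRPC3) (fun n e d => e * n * d ^ 3) &
      bigO (branch_time lmaxRPC3) (fun n e d => e * n * d ^ 3)].
Proof.
by split; [apply: node_time_bigO|apply: branch_time_bigO
          |apply: node_time_bigO|apply: branch_time_bigO].
Qed.
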